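(* Let $F^m=(M,M',F^{\ast})$ be a pseudo-Finsler manifold, $HM'$ a nonlinear connection on $M'$, and $S,T$ two skew-symmetric Finsler tensor fields of type $(1,2)$ on $F^m$. Let $FC=(HM',\nabla)$ be the $(HM',S,T)$-Cartan connection and let $\mathcal{D}$ be the natural almost complex linear connection associated to it. Then $\mathcal{D}$ is a metric linear connection with respect to the Sasaki-type metric $G$ on $M'$, i.e. $\mathcal{D}_XG=0$ for all $X\in\Gamma(TM')$.
   Context: Let $M$ be a real $m$-dimensional smooth manifold, $\pi:TM\to M$ its tangent bundle with zero section $\theta$, and $M'\subset TM$ a nonempty open submanifold with $\pi(M')=M$ and $\theta(M)\cap M'=\varnothing$, with induced local coordinates $(x^i,y^i)$. A pseudo-Finsler manifold $F^m=(M,M',F^{\ast})$ is given by a smooth function $F^{\ast}:M'\to\mathbb{R}$ that is positively homogeneous of degree two in $y$, i.e. $F^{\ast}(x,ky)=k^2F^{\ast}(x,y)$ for $k>0$ (whenever both sides are defined), and such that $g_{ij}=\frac12\frac{\partial^2F^{\ast}}{\partial y^i\partial y^j}$ are at each point the components of a quadratic form on $\mathbb{R}^m$ with $q$ negative and $m-q$ positive eigenvalues, $0<q<m$. $VM'=\ker(\pi_{\ast}|_{TM'})$ is the vertical vector bundle, locally spanned by $\frac{\partial}{\partial y^i}$; $g$ denotes the pseudo-Riemannian metric on $VM'$ with $g(\frac{\partial}{\partial y^i},\frac{\partial}{\partial y^j})=g_{ij}$. A nonlinear connection is a distribution $HM'$ with $TM'=HM'\oplus VM'$; it is locally spanned by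 $\frac{\delta}{\delta x^i}=\frac{\partial}{\partial x^i}-N^j_i(x,y)\frac{\partial}{\partial y^j}$. $h$ and $v$ are the projections of $TM'$ onto $HM'$ and $VM'$. The associate almost complex structure to $HM'$ is the bundle map $J:TM'\to TM'$ with $J(\frac{\delta}{\delta x^i})=-\frac{\partial}{\partial y^i}$, $J(\frac{\partial}{\partial y^i})=\frac{\delta}{\delta x^i}$. A skew-symmetric Finsler tensor field of type $(1,2)$ is a skew-symmetric $C^\infty(M')$-bilinear map $\Gamma(VM')\times\Gamma(VM')\to\Gamma(VM')$. For a linear connection $\nabla$ on $VM'$ (covariant derivative of vertical sections along arbitrary $X\in\Gamma(TM')$), the natural almost complex linear connection associated to $(HM',\nabla)$ is the linear connection on $M'$ given by $\mathcal{D}_XY=\nabla_XvY-J\nabla_XJhY$ for $X,Y\in\Gamma(TM')$, with torsion $T^{\mathcal{D}}(X,Y)=\mathcal{D}_XY-\mathcal{D}_YX-[X,Y]$. The $(HM',S,T)$-Cartan connection is the pair $(HM',\nabla)$, where $\nabla$ is the unique linear connection on $VM'$ such that $\nabla_Xg=0$ for all $X\in\Gamma(TM')$ and, for all $X,Y\in\Gamma(TM')$, $T^{\mathcal{D}}(vX,vY)=S(vX,vY)$ and $hT^{\mathcal{D}}(hX,hY)=J\,T(JhX,JhY)$. The Sasaki-type metric is $G=g_{ij}(x,y)dx^idx^j+g_{ij}(x,y)\delta y^i\delta y^j$ with $\delta y^i=dy^i+N^i_j(x,y)dx^j$; that is, $G(\frac{\delta}{\delta x^i},\frac{\delta}{\delta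 x^j})=G(\frac{\partial}{\partial y^i},\frac{\partial}{\partial y^j})=g_{ij}$ and $G(\frac{\delta}{\delta x^i},\frac{\partial}{\partial y^j})=0$. *)

(* Defs.v *)
From HB Require Import structures.
From mathcomp Require Import all_boot all_order all_algebra.
From mathcomp Require Import all_classical all_reals all_analysis.
Set Implicit Arguments.
Unset Strict Implicit.
Unset Printing Implicit Defensive.
Import Order.TTheory GRing.Theory Num.Theory numFieldNormedType.Exports.
Local Open Scope classical_set_scope.
Local Open Scope ring_scope.

(* C^k and C^oo on an open set U; the values of f outside U are irrelevant. *)
Fixpoint Ck_on (R : realType) (n : nat) (W : normedModType R) (k : nat)
    (U : set 'rV[R]_n) (f : 'rV[R]_n -> W) : Prop :=
  match k with
  | 0 => forall u, U u -> {for u, continuous f}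
  | k'.+1 => (forall u, U u -> differentiable f u) /\
             (forall w : 'rV[R]_n, Ck_on k' U (fun u => 'D_w f u))
  end.

Definition smooth_on (R : realType) (n : nat) (W : normedModType R)
    (U : set 'rV[R]_n) (f : 'rV[R]_n -> W) : Prop :=
  forall k, Ck_on k U f.

(* Only the data of an atlas on T: the compatibility conditions are in
   [smooth_manifold]. The map [coord i] is meaningful on [dom i] only, and
   [chart_at] singles out one chart around each point. *)
Record atlas (R : realType) (n : nat) (T : Type) := Atlas {
  idx : Type;
  dom : idx -> set T;
  coord : idx -> T -> 'rV[R]_n;
  chart_at : T -> idx;
  chart_atP : forall p, dom (chart_at p) p }.

Section Charts.
Context (R : realType) (n : nat) (T : Type) (A : atlas R n T).

Definition chart_image (i : idx A) : set 'rV[R]_n := coord i @` dom i.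

Definition chart_open (U : set T) : Prop :=
  forall i : idx A, open (coord i @` (dom i `&` U)).

(* The local representative f o (coord i)^-1, equal to 0 off the chart image. *)
Definition rep (W : normedModType R) (f : T -> W) (i : idx A)
    (u : 'rV[R]_n) : W :=
  xget 0 [set w | exists2 p, dom i p & coord i p = u /\ w = f p].

Definition smooth_fun (f : T -> R) : Prop :=
  forall i : idx A, smooth_on (chart_image i) (rep f i).

(* A tangent vector at p is the family of its components in all the charts
   around p (and 0 in the others), transforming with the Jacobian. *)
Definition comps : Type := idx A -> 'rV[R]_n.

Definition tangent (p : T) (v : comps) : Prop :=
  (forall i, ~ dom i p -> v i = 0) /\
  (forall i j, dom i p -> dom j p ->
     v j = 'd (rep (coord j) i) (coord i p) (v i)).

(* The tangent vector at p with components w in the chart i. *)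
Definition coord_vec (i : idx A) (p : T) (w : 'rV[R]_n) : comps := fun j =>
  if `[< dom j p >] then 'd (rep (coord j) i) (coord i p) w else 0.

Definition vfield : Type := T -> comps.

Definition fscale (f : T -> R) (X : vfield) : vfield := fun p => f p *: X p.

Definition smooth_vfield (X : vfield) : Prop :=
  (forall p, tangent p (X p)) /\
  (forall i, smooth_on (chart_image i) (rep (fun p => X p i) i)).

(* X f *)
Definition der (X : vfield) (f : T -> R) (p : T) : R :=
  'd (rep f (chart_at A p)) (coord (chart_at A p) p) (X p (chart_at A p)).

(* [X, Y]^i = X(Y^i) - Y(X^i) *)
Definition bracket (X Y : vfield) : vfield := fun p i =>
  if `[< dom i p >] then
    'd (rep (fun z => Y z i) i) (coord i p) (X p i)
    - 'd (rep (fun z => X z i) i) (coord i p) (Y p i)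
  else 0.

(* [E] is the set of smooth sections of a subbundle of the tangent bundle. *)
Definition linear_connection (E : set vfield)
    (nabla : vfield -> vfield -> vfield) : Prop :=
  [/\ forall X Y, smooth_vfield X -> E Y -> E (nabla X Y),
      forall X X' Y, smooth_vfield X -> smooth_vfield X' -> E Y ->
        nabla (X + X') Y = nabla X Y + nabla X' Y,
      forall f X Y, smooth_fun f -> smooth_vfield X -> E Y ->
        nabla (fscale f X) Y = fscale f (nabla X Y),
      forall X Y Y', smooth_vfield X -> E Y -> E Y' ->
        nabla X (Y + Y') = nabla X Y + nabla X Y' &
      forall f X Y, smooth_fun f -> smooth_vfield X -> E Y ->
        nabla X (fscale f Y) = fscale (der X f) Y + fscale f (nabla X Y)].

Definition torsion (D : vfield -> vfield -> vfield) (X Y : vfield) : vfield :=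
  D X Y - D Y X - bracket X Y.

(* A field of bilinear forms on the fibres of a subbundle V. *)
Definition fibre_bilinear (V : T -> set comps) (b : T -> comps -> comps -> R) :
    Prop :=
  forall p (c : R) u v w, V p u -> V p v -> V p w ->
    b p (c *: u + v) w = c * b p u w + b p v w /\
    b p w (c *: u + v) = c * b p w u + b p w v.

(* (nabla_X b)(Y, Z) *)
Definition cov_der (nabla : vfield -> vfield -> vfield)
    (b : T -> comps -> comps -> R) (X Y Z : vfield) (p : T) : R :=
  der X (fun z => b z (Y z) (Z z)) p
  - b p (nabla X Y p) (Z p) - b p (Y p) (nabla X Z p).

Definition metric_connection (E : set vfield)
    (nabla : vfield -> vfield -> vfield) (b : T -> comps -> comps -> R) : Prop :=
  forall X Y Z, smooth_vfield X -> E Y -> E Z ->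
    forall p, cov_der nabla b X Y Z p = 0.

End Charts.

(* The differential f_* at p. *)
Definition push (R : realType) (n n' : nat) (T T' : Type) (A : atlas R n T)
    (A' : atlas R n' T') (f : T -> T') (p : T) (v : comps A) : comps A' :=
  fun j => if `[< dom j (f p) >] then
    'd (rep (fun z => coord j (f z)) (chart_at A p))
       (coord (chart_at A p) p) (v (chart_at A p))
  else 0.

Definition smooth_manifold (R : realType) (m : nat) (M : topologicalType)
    (A : atlas R m M) : Prop :=
  [/\ hausdorff_space M,
      @second_countable M,
      forall i : idx A, open (dom i) /\ {in dom i &, injective (coord i)},
      forall (i : idx A) (U : set M), U `<=` dom i ->
        (open U <-> open (coord i @` U)) &
      forall i j : idx A,
        smooth_on (coord i @` (dom i `&` dom j)) (rep (coord j) i)].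

Record tangent_bundle (R : realType) (n : nat) (T : Type) (A : atlas R n T) :=
  TVec { base : T; vec : comps A; vecP : tangent base vec }.

(* The induced coordinates (x^1, ..., x^n, y^1, ..., y^n) on the total space. *)
Definition tangent_atlas (R : realType) (n : nat) (T : Type)
    (A : atlas R n T) : atlas R (n + n) (tangent_bundle A) :=
  @Atlas R (n + n) (tangent_bundle A) (idx A)
    (fun i => [set z | dom i (base z)])
    (fun i z => row_mx (coord i (base z)) (vec z i))
    (fun z => chart_at A (base z))
    (fun z => chart_atP A (base z)).

Definition sub_atlas (R : realType) (n : nat) (T : Type) (A : atlas R n T)
    (U : set T) : atlas R n U :=
  @Atlas R n U (idx A)
    (fun i => [set p : U | dom i (val p)])
    (fun i p => coord i (val p))
    (fun p => chart_at A (val p))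
    (fun p => chart_atP A (val p)).

Section PseudoFinsler.
Context (R : realType) (m : nat) (M : Type) (A : atlas R m M).
Context (M' : set (tangent_bundle A)).

Definition AM' : atlas R (m + m) M' := sub_atlas (tangent_atlas A) M'.

Definition e_x (a : 'I_m) : 'rV[R]_(m + m) := row_mx (delta_mx 0 a) 0.
Definition e_y (a : 'I_m) : 'rV[R]_(m + m) := row_mx 0 (delta_mx 0 a).

Definition d_x (i : idx AM') (p : M') (a : 'I_m) : comps AM' :=
  coord_vec i p (e_x a).
Definition d_y (i : idx AM') (p : M') (a : 'I_m) : comps AM' :=
  coord_vec i p (e_y a).

Definition proj (p : M') : M := base (val p).

(* g_ab = (1/2) d^2 F / dy^a dy^b, as functions of (x, y) in the chart i. *)
Definition fundamental (F : M' -> R) (i : idx AM') (u : 'rV[R]_(m + m)) :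
    'M[R]_m :=
  \matrix_(a, b)
    (2^-1 * 'D_(e_y a) (fun w => 'D_(e_y b) (rep (A := AM') F i) w) u).

(* Eigenvalues are counted with multiplicity. *)
Definition has_signature (q : nat) (B : 'M[R]_m) : Prop :=
  exists s : seq R,
    [/\ char_poly B = \prod_(a <- s) ('X - a%:P),
        count (fun a => a < 0) s = q &
        count (fun a => 0 < a) s = (m - q)%N].

Definition pseudo_finsler (q : nat) (F : M' -> R) : Prop :=
  [/\ [/\ M' !=set0, chart_open (tangent_atlas A) M',
          (@base _ _ _ A) @` M' = setT &
          forall z, M' z -> vec z <> 0],
      smooth_fun AM' F,
      forall (p p' : M') (k : R), 0 < k ->
        base (val p') = base (val p) -> vec (val p') = k *: vec (val p) ->
        F p' = k ^+ 2 * F p,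
      (0 < q < m)%N &
      forall (i : idx AM') (p : M'), dom i p ->
        has_signature q (fundamental F i (coord i p))].

(* VM' = ker pi_* *)
Definition vertical (p : M') : set (comps AM') :=
  [set v | tangent p v /\ push (A' := A) proj p v = 0].

Definition vertical_vfield : set (vfield AM') :=
  [set X | smooth_vfield X /\ forall p, vertical p (X p)].

Definition vertical_metric (F : M' -> R)
    (g : M' -> comps AM' -> comps AM' -> R) : Prop :=
  fibre_bilinear vertical g /\
  forall (i : idx AM') (p : M') (a b : 'I_m), dom i p ->
    g p (d_y i p a) (d_y i p b) = fundamental F i (coord i p) a b.

(* delta/delta x^a = d/dx^a - N^b_a d/dy^b; the entry (b, a) of the matrix N is
   N^b_a. *)
Definition delta_x (N : idx AM' -> 'rV[R]_(m + m) -> 'M[R]_m)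
    (i : idx AM') (p : M') (a : 'I_m) : comps AM' :=
  d_x i p a - \sum_b N i (coord i p) b a *: d_y i p b.

(* N gives the (uniquely determined) local coefficients of the distribution H. *)
Definition nonlinear_connection (H : M' -> set (comps AM'))
    (N : idx AM' -> 'rV[R]_(m + m) -> 'M[R]_m) : Prop :=
  [/\ forall p v, H p v -> tangent p v,
      forall p v, tangent p v -> exists! w, H p w /\ vertical p (v - w),
      forall i, smooth_on (chart_image i) (N i) &
      forall (i : idx AM') (p : M'), dom i p ->
        H p = [set v | exists c : 'I_m -> R,
                 v = \sum_a c a *: delta_x N i p a]].

Definition hpart (H : M' -> set (comps AM')) (X : vfield AM') : vfield AM' :=
  fun p => xget 0 [set w | H p w /\ vertical p (X p - w)].
Definition vpart (H : M' -> set (comps AM')) (X : vfield AM') : vfield AM' :=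
  X - hpart H X.

Definition on_fields (J : M' -> comps AM' -> comps AM') (X : vfield AM') :
    vfield AM' := fun p => J p (X p).

Definition bundle_map (J : M' -> comps AM' -> comps AM') : Prop :=
  [/\ forall p v, tangent p v -> tangent p (J p v),
      forall p (c : R) v w, tangent p v -> tangent p w ->
        J p (c *: v + w) = c *: J p v + J p w &
      forall X, smooth_vfield X -> smooth_vfield (on_fields J X)].

Definition almost_complex (N : idx AM' -> 'rV[R]_(m + m) -> 'M[R]_m)
    (J : M' -> comps AM' -> comps AM') : Prop :=
  bundle_map J /\
  forall (i : idx AM') (p : M') (a : 'I_m), dom i p ->
    J p (delta_x N i p a) = - d_y i p a /\ J p (d_y i p a) = delta_x N i p a.

Definition skew_finsler_tensor (S : vfield AM' -> vfield AM' -> vfield AM') :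
    Prop :=
  [/\ forall X Y, vertical_vfield X -> vertical_vfield Y ->
        vertical_vfield (S X Y),
      forall X Y, vertical_vfield X -> vertical_vfield Y ->
        S X Y = - S Y X &
      forall f X X' Y, smooth_fun AM' f ->
        vertical_vfield X -> vertical_vfield X' -> vertical_vfield Y ->
        S (fscale f X + X') Y = fscale f (S X Y) + S X' Y /\
        S Y (fscale f X + X') = fscale f (S Y X) + S Y X'].

Definition natural_connection (H : M' -> set (comps AM'))
    (J : M' -> comps AM' -> comps AM')
    (nabla : vfield AM' -> vfield AM' -> vfield AM') :
    vfield AM' -> vfield AM' -> vfield AM' :=
  fun X Y => nabla X (vpart H Y)
             - on_fields J (nabla X (on_fields J (hpart H Y))).

Definition cartan_connection (g : M' -> comps AM' -> comps AM' -> R)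
    (H : M' -> set (comps AM')) (J : M' -> comps AM' -> comps AM')
    (S T : vfield AM' -> vfield AM' -> vfield AM')
    (nabla : vfield AM' -> vfield AM' -> vfield AM') : Prop :=
  let tors := torsion (natural_connection H J nabla) in
  let h := hpart H in let v := vpart H in
  [/\ linear_connection vertical_vfield nabla,
      metric_connection vertical_vfield nabla g,
      forall X Y, smooth_vfield X -> smooth_vfield Y ->
        tors (v X) (v Y) = S (v X) (v Y) &
      forall X Y, smooth_vfield X -> smooth_vfield Y ->
        h (tors (h X) (h Y))
        = on_fields J (T (on_fields J (h X)) (on_fields J (h Y)))].

Definition sasaki_metric (F : M' -> R)
    (N : idx AM' -> 'rV[R]_(m + m) -> 'M[R]_m)
    (G : M' -> comps AM' -> comps AM' -> R) : Prop :=
  fibre_bilinear (@tangent _ _ _ AM') G /\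
  forall (i : idx AM') (p : M') (a b : 'I_m), dom i p ->
    [/\ G p (delta_x N i p a) (delta_x N i p b)
          = fundamental F i (coord i p) a b,
        G p (d_y i p a) (d_y i p b) = fundamental F i (coord i p) a b,
        G p (delta_x N i p a) (d_y i p b) = 0 &
        G p (d_y i p b) (delta_x N i p a) = 0].

End PseudoFinsler.

(* Main.v *)
From HB Require Import structures.
Require Import Defs.
From mathcomp Require Import all_boot all_order all_algebra.
From mathcomp Require Import all_classical all_reals all_analysis.
From mathcomp Require Import ring.
Import Order.TTheory GRing.Theory Num.Theory numFieldNormedType.Exports.
(* Among the names coord, the one for charts has to take precedence over the
   coordinates in a basis of a vector space. *)
Import Defs.
Set Implicit Arguments.
Unset Strict Implicit.
Unset Printing Implicit Defensive.
Local Open Scope classical_set_scope.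
Local Open Scope ring_scope.

(** Why the theorem is true.  Write X = hX + vX.  The Sasaki-type metric makes
    HM' and VM' orthogonal, and J carries the frame (delta/delta x^a) to
    (- d/dy^a), on which G and g have the same matrix g_ab; hence
      G(Y, Z) = g(vY, vZ) + g(JhY, JhZ)                      [sasaki_split].
    Since J^2 = -1, the field D_X Y = nabla_X vY - J nabla_X JhY satisfies
      v D_X Y = nabla_X vY   and   J h D_X Y = nabla_X JhY   [natural_parts],
    so that (D_X G)(Y, Z) is the sum of (nabla_X g)(vY, vZ) and
    (nabla_X g)(JhY, JhZ), and both terms vanish: nabla is metric.

    That D is a linear connection is the same kind of computation: h, v and J
    are linear on fibres, and the derivatives Xf in the Leibniz rules of the two
    summands add up to Xf vY - J(Xf JhY) = Xf (vY + hY) = Xf Y.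

    The analytic content is regularity.  nabla may be applied to vY and JhY
    only because these are smooth vertical fields, and X(G(Y, Z)) splits as a
    sum only because g(vY, vZ) and g(JhY, JhZ) are differentiable.  Both follow
    from coordinate expressions in which the coefficients N^b_a and the second
    derivatives g_ab of F are smooth [smooth_hpart, differentiable_g].  The
    bridge between fields and coordinates is that a tangent vector of M' is
    determined by its components (x, y) in a single chart, that it is vertical
    exactly when x = 0 [verticalP], and that its horizontal part is then
    sum_a x^a delta/delta x^a [hpartE].  *)

(** * Calculus: differentials and smooth maps between normed spaces *)

Lemma near_eq_diff (R : numFieldType) (V W : normedModType R) (f g : V -> W) x :
  {near x, f =1 g} -> differentiable f x ->
  differentiable g x /\ 'd g x = 'd f x :> (V -> W).
Proof.
move=> fg df.
have dg : g \o shift x = cst (g x) + 'd f x +o_ 0 id.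
  have fgx : f x = g x by exact: (nbhs_singleton fg).
  move/diff_locally: (df) => /eqaddoP dfx.
  have fg0 : \forall h \near (0 : V), f (h + x) = g (h + x).
    have : \near x, f x = g x by [].
    by rewrite (near_shift 0) subr0.
  apply/eqaddoP => e e0; have := dfx e e0; apply: filterS2 fg0 => h fgh.
  by rewrite !fctE /= fgh fgx.
have deq : 'd g x = 'd f x :> (V -> W).
  by apply: diff_unique dg; exact: diff_continuous.
split=> //; apply/diff_locallyP; split; rewrite deq //.
exact: diff_continuous.
Qed.

(** The differential is chosen among the continuous linear maps with the
    required expansion, and the default choice is the zero map. *)
Lemma diff_not_differentiable (R : numFieldType) (V W : normedModType R)
    (f : V -> W) x v :
  ~ differentiable f x -> 'd f x v = 0.
Proof.
move=> nd; have [ex|nex] := pselect (exists df : {linear V -> W},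
   continuous df /\ forall y, f y = f (lim (nbhs x)) + df (y - lim (nbhs x))
                  +o_(y \near x) (y - lim (nbhs x))).
  by exfalso; apply: nd; apply/diffP; exact: getPex ex.
by rewrite /diff getPN // => df Pdf; apply: nex; exists df.
Qed.

Section Smooth.
Context (R : realType) (n : nat).
Implicit Types (W : normedModType R) (U : set 'rV[R]_n) (k : nat).

(** Iterated derivatives of a sum or a product are computed on U only, so the
    inductive steps below replace a function by one that agrees with it there;
    as U is open, this changes no derivative at a point of U. *)
Lemma Ck_on_eq W U k (f g : 'rV[R]_n -> W) :
  open U -> (forall u, U u -> f u = g u) -> Ck_on k U f -> Ck_on k U g.
Proof.
move=> oU fg.
have near_fg h1 h2 u : (forall u, U u -> h1 u = h2 u) -> U u ->
    {near u, h1 =1 h2 :> ('rV[R]_n -> W)}.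
  move=> h12 Uu; near=> z; apply: h12.
  by near: z; exact: open_nbhs_nbhs.
elim: k f g fg => [|k IH] f g fg /=.
  move=> cf u Uu; suff : g z @[z --> u] --> g u by [].
  rewrite -(fg u Uu); apply: cvg_trans (cf u Uu).
  exact: (near_eq_cvg (F := nbhs u) (near_fg _ _ _ fg Uu)).
move=> [df Df]; split=> [u Uu|w].
  by have [] := near_eq_diff (near_fg _ _ _ fg Uu) (df u Uu).
apply: IH (Df w) => u Uu; exact: near_eq_derive (near_fg _ _ _ fg Uu).
Unshelve. all: by end_near. Qed.

Lemma Ck_onS W U k (f : 'rV[R]_n -> W) : Ck_on k.+1 U f -> Ck_on k U f.
Proof.
elim: k f => [|k IH] f [df Df] /=.
  by move=> u Uu; apply: differentiable_continuous; exact: df.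
by split=> // w; apply: IH (Df w).
Qed.

Lemma Ck_on_cst W U k (c : W) : Ck_on k U (cst c : 'rV[R]_n -> W).
Proof.
elim: k c => [|k IH] c /=; first by move=> u _; exact: cst_continuous.
split=> [u _|w]; first exact: differentiable_cst.
rewrite (_ : (fun u => _) = cst 0); first exact: IH.
by apply/funext => u; rewrite derive_cst.
Qed.

Lemma Ck_onD W U k (f g : 'rV[R]_n -> W) :
  open U -> Ck_on k U f -> Ck_on k U g -> Ck_on k U (f + g).
Proof.
move=> oU; elim: k f g => [|k IH] f g /=.
  by move=> cf cg u Uu; exact: (cvgD (cf u Uu) (cg u Uu)).
move=> [df Df] [dg Dg]; split=> [u Uu|w].
  by apply: differentiableD; [exact: df|exact: dg].
apply: Ck_on_eq (IH _ _ (Df w) (Dg w)) => // u Uu /=.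
by rewrite deriveD //; apply: diff_derivable; [exact: df|exact: dg].
Qed.

Lemma Ck_on_lin W W' U k (L : {linear W -> W'}) (f : 'rV[R]_n -> W) :
  open U -> continuous L -> Ck_on k U f -> Ck_on k U (L \o f).
Proof.
move=> oU cL; elim: k f => [|k IH] f /=.
  by move=> cf u Uu; apply: continuous_comp; [exact: cf|exact: cL].
have dL w : differentiable L w by exact: linear_differentiable.
move=> [df Df]; split=> [u Uu|w].
  by apply: differentiable_comp => //; exact: df.
apply: Ck_on_eq (IH _ (Df w)) => // u Uu /=.
have dfu := df u Uu.
rewrite !deriveE //; last exact: differentiable_comp.
have dLE : 'd L (f u) = L :> (W -> W') by exact: diff_lin.
by rewrite (diff_comp dfu (dL _)) /= dLE.
Qed.

Lemma Ck_onM U k (f g : 'rV[R]_n -> R) :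
  open U -> Ck_on k U f -> Ck_on k U g -> Ck_on k U (f * g).
Proof.
move=> oU; elim: k f g => [|k IH] f g /=.
  by move=> cf cg u Uu; exact: (cvgM (cf u Uu) (cg u Uu)).
move=> cf cg.
have /Ck_onS cf' : Ck_on k.+1 U f by [].
have /Ck_onS cg' : Ck_on k.+1 U g by [].
case: cf cg => [df Df] [dg Dg]; split=> [u Uu|w].
  by apply: differentiableM; [exact: df|exact: dg].
apply: Ck_on_eq (Ck_onD oU (IH _ _ cf' (Dg w)) (IH _ _ cg' (Df w))) => // u Uu.
by rewrite deriveM //; apply: diff_derivable; [exact: df|exact: dg].
Qed.

Lemma smooth_onD W U (f g : 'rV[R]_n -> W) :
  open U -> smooth_on U f -> smooth_on U g -> smooth_on U (f + g).
Proof. by move=> oU sf sg k; exact: Ck_onD. Qed.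

Lemma smooth_onM U (f g : 'rV[R]_n -> R) :
  open U -> smooth_on U f -> smooth_on U g -> smooth_on U (f * g).
Proof. by move=> oU sf sg k; exact: Ck_onM. Qed.

Lemma smooth_on_lin W W' U (L : {linear W -> W'}) (f : 'rV[R]_n -> W) :
  open U -> continuous L -> smooth_on U f -> smooth_on U (L \o f).
Proof. by move=> oU cL sf k; exact: Ck_on_lin. Qed.

Lemma smooth_on_sum (I : Type) (r : seq I) W U (f : I -> 'rV[R]_n -> W) :
  open U -> (forall i, smooth_on U (f i)) ->
  smooth_on U (fun u => \sum_(i <- r) f i u).
Proof.
move=> oU sf; elim: r => [|i r IH].
  rewrite (_ : (fun u => _) = cst 0); first by move=> k; exact: Ck_on_cst.
  by apply/funext => u; rewrite big_nil.
rewrite (_ : (fun u => _) = f i + (fun u => \sum_(i <- r) f i u)).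
  exact: smooth_onD.
by apply/funext => u; rewrite big_cons.
Qed.

Lemma smooth_on_coord a b U (f : 'rV[R]_n -> 'M[R]_(a, b)) i j :
  open U -> smooth_on U f -> smooth_on U (fun u => f u i j : R).
Proof.
move=> oU sf.
have lin : linear (fun M : 'M[R]_(a, b) => M i j : R^o).
  by move=> c M M'; rewrite !mxE.
pose L : {linear 'M[R]_(a, b) -> R^o} := HB.pack (fun M : 'M[R]_(a, b) => M i j)
  (GRing.isLinear.Build _ _ _ _ _ lin).
have cL : continuous (L : 'M[R]_(a, b) -> R) by exact: coord_continuous.
exact: (@smooth_on_lin _ R^o U L f).
Qed.

Lemma smooth_onZl W U (c : 'rV[R]_n -> R) (w : W) :
  open U -> smooth_on U c -> smooth_on U (fun u => c u *: w).
Proof.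
move=> oU sc.
have lin : linear (fun x : R^o => x *: w).
  by move=> a x y; rewrite scalerDl scalerA.
pose L : {linear R^o -> W} := HB.pack (fun x : R^o => x *: w)
  (GRing.isLinear.Build _ _ _ _ _ lin).
have cL : continuous (L : R -> W) by exact: scalel_continuous.
exact: (@smooth_on_lin R^o W U L c).
Qed.

Lemma smooth_onN W U (f : 'rV[R]_n -> W) :
  open U -> smooth_on U f -> smooth_on U (- f).
Proof.
move=> oU sf; apply: (@smooth_on_lin W W U -%R) => //; exact: opp_continuous.
Qed.

Lemma smooth_on_derive W U (f : 'rV[R]_n -> W) w :
  smooth_on U f -> smooth_on U (fun u => 'D_w f u).
Proof. by move=> sf k; have [_] := sf k.+1; apply. Qed.

Lemma smooth_on_differentiable W U (f : 'rV[R]_n -> W) u :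
  smooth_on U f -> U u -> differentiable f u.
Proof. by move=> sf Uu; have [df _] := sf 1%N; exact: df. Qed.

End Smooth.

(** * Linear algebra on the fibres, and fields on an atlas *)

(** V stands for a linear subspace, such as the tangent vectors at a point among
    all families of components: linearity of L is assumed on V alone. *)
Lemma lin_sum (R : pzRingType) (E E' : lmodType R) (V : set E) (L : E -> E')
    (I : Type) (r : seq I) (c : I -> R) (e : I -> E) :
  V 0 -> (forall (a : R) u v, V u -> V v -> V (a *: u + v)) ->
  (forall (a : R) u v, V u -> V v -> L (a *: u + v) = a *: L u + L v) ->
  (forall i, V (e i)) ->
  L (\sum_(i <- r) c i *: e i) = \sum_(i <- r) c i *: L (e i).
Proof.
move=> V0 VL LL Ve.
suff [//] : L (\sum_(i <- r) c i *: e i) = \sum_(i <- r) c i *: L (e i) /\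
    V (\sum_(i <- r) c i *: e i).
elim: r => [|i r [IH Vr]].
  rewrite !big_nil; split=> //.
  by have := LL (-1) 0 0 V0 V0; rewrite scaler0 addr0 scaleN1r addNr.
by rewrite !big_cons; split; [rewrite LL // IH | exact: VL].
Qed.

Section Atlas.
Context (R : realType) (n : nat) (T : Type) (A : atlas R n T).
Implicit Types (W : normedModType R) (i j : idx A) (p : T) (X Y : vfield A).
Hypothesis inj_coord : forall i p p',
  dom i p -> dom i p' -> coord i p = coord i p' -> p = p'.
Hypothesis open_image : forall i, open (chart_image i).

Lemma repE W (f : T -> W) i p : dom i p -> rep f i (coord i p) = f p.
Proof.
move=> ip; rewrite /rep; case: xgetP => [w _ [p' ip' [ep ->]]|nex].
  by rewrite (inj_coord ip' ip ep).
by have := nex (f p); case; exists p.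
Qed.

Lemma rep_out W (f : T -> W) i u : ~ chart_image i u -> rep f i u = 0.
Proof.
by move=> nu; rewrite /rep xgetPN // => w [p ip [eu _]]; apply: nu; exists p.
Qed.

(** Representatives vanish off the chart image, so an algebraic identity between
    functions lifts to an identity between representatives on the whole space,
    and not only on the chart image. *)
Lemma rep_unique W (f : T -> W) i (h : 'rV[R]_n -> W) :
  (forall p, dom i p -> h (coord i p) = f p) ->
  (forall u, ~ chart_image i u -> h u = 0) -> rep f i = h.
Proof.
move=> hin hout; apply/funext => u.
have [[p ip <-]|nu] := pselect (chart_image i u); first by rewrite repE ?hin.
by rewrite hout // rep_out.
Qed.

Lemma comps_lin (c : R) (u v : comps A) i : (c *: u + v) i = c *: u i + v i.
Proof. by []. Qed.

Lemma comps_sum (I : Type) (r : seq I) (f : I -> comps A) i :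
  (\sum_(k <- r) f k) i = \sum_(k <- r) f k i.
Proof. by elim/big_rec2: _ => // k x y _ <-. Qed.

Lemma fibre_bilinear_sum (V : T -> set (comps A))
    (b : T -> comps A -> comps A -> R) p
    (I I' : finType) (c : I -> R) (c' : I' -> R) e e' :
  fibre_bilinear V b -> V p 0 ->
  (forall (a : R) u v, V p u -> V p v -> V p (a *: u + v)) ->
  (forall k, V p (e k)) -> (forall k, V p (e' k)) ->
  b p (\sum_k c k *: e k) (\sum_k c' k *: e' k)
  = \sum_k \sum_k' c k * (c' k' * b p (e k) (e' k')).
Proof.
move=> bil V0 VL Ve Ve'.
have Ve's : V p (\sum_k c' k *: e' k).
  elim/big_ind: _ => [//|u v Vu Vv|k _].
    by rewrite -[u]scale1r; exact: VL.
  by rewrite -[_ *: _]addr0; exact: VL.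
have -> : b p (\sum_k c k *: e k) (\sum_k c' k *: e' k)
        = \sum_k c k * b p (e k) (\sum_k c' k *: e' k).
  apply: (lin_sum (E' := R^o) (V := V p) (L := b p ^~ _)) => // a u v Vu Vv.
  by have [-> _] := bil p a u v _ Vu Vv Ve's.
apply: eq_bigr => k _; rewrite -mulr_sumr; congr (_ * _).
apply: (lin_sum (E' := R^o) (V := V p) (L := b p (e k))) => // a u v Vu Vv.
by have [_ ->] := bil p a u v _ Vu Vv (Ve k).
Qed.

Lemma tangent_comb p (c : R) (u v : comps A) :
  tangent p u -> tangent p v -> tangent p (c *: u + v).
Proof.
move=> [u0 tu] [v0 tv]; split=> [i ni|i j ip jp].
  by rewrite comps_lin u0 // v0 // scaler0 addr0.
by rewrite !comps_lin linearP -(tu i j) // -(tv i j).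
Qed.

Lemma tangent0 p : tangent p (0 : comps A).
Proof. by split=> [//|i j ip jp]; rewrite [RHS]linear0. Qed.

(** The components in one chart determine the others through the Jacobians; this
    is what reduces identities between tangent vectors to a single chart. *)
Lemma tangent_inj i p (u v : comps A) :
  dom i p -> tangent p u -> tangent p v -> u i = v i -> u = v.
Proof.
move=> ip [u0 tu] [v0 tv] uvi; apply/funext => j.
have [jp|nj] := pselect (dom j p); last by rewrite u0 // v0.
by rewrite (tu i j) // (tv i j) // uvi.
Qed.

Lemma smooth_vfieldD X Y :
  smooth_vfield X -> smooth_vfield Y -> smooth_vfield (X + Y).
Proof.
move=> [tX sX] [tY sY]; split=> [p|i].
  by have := tangent_comb 1 (tX p) (tY p); rewrite scale1r.
rewrite (_ : rep _ i = rep (fun p => X p i) i + rep (fun p => Y p i) i).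
  by apply: smooth_onD.
apply: rep_unique => [p ip|u nu]; rewrite !fctE.
  by rewrite !repE.
by rewrite !rep_out // addr0.
Qed.

Lemma smooth_vfieldN X : smooth_vfield X -> smooth_vfield (- X).
Proof.
move=> [tX sX]; split=> [p|i].
  by have := tangent_comb (-1) (tX p) (tangent0 p); rewrite scaleN1r addr0.
rewrite (_ : rep _ i = - rep (fun p => X p i) i).
  by apply: smooth_onN.
apply: rep_unique => [p ip|u nu]; rewrite !fctE.
  by rewrite !repE.
by rewrite !rep_out // oppr0.
Qed.

(** Near a point of its image, the transition map from a chart to itself is the
    identity. *)
Lemma coord_vec_id i p w : dom i p -> coord_vec i p w i = w.
Proof.
move=> ip; rewrite /coord_vec asboolT //.
have nid : {near coord i p, id =1 rep (coord i) i}.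
  near=> u; have [q iq <-] : chart_image i u.
    by near: u; apply: open_nbhs_nbhs; split=> //; exists p.
  by rewrite repE.
have did : differentiable (id : 'rV[R]_n -> _) (coord i p) by [].
have [_ ->] := near_eq_diff nid did.
by rewrite (diff_val (df := id)).
Unshelve. all: by end_near. Qed.

Lemma derD X (f g : T -> R) p :
  differentiable (rep f (chart_at A p)) (coord (chart_at A p) p) ->
  differentiable (rep g (chart_at A p)) (coord (chart_at A p) p) ->
  der X (f + g) p = der X f p + der X g p.
Proof.
rewrite /der; set i := chart_at A p => df dg.
rewrite (_ : rep (f + g) i = rep f i + rep g i); first by rewrite diffD.
apply: rep_unique => [q iq|u nu]; rewrite !fctE; first by rewrite !repE.
by rewrite !rep_out // addr0.
Qed.

End Atlas.

(** * Charts and vertical vectors on an open subset of TM *)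

Section TangentSubset.
Context (R : realType) (m : nat) (M : topologicalType) (A : atlas R m M).
Context (M' : set (tangent_bundle A)).
Let B := AM' M'.
Implicit Types (i j : idx B) (p : M') (X Y Z : vfield B).
Hypothesis mfdA : smooth_manifold A.
Hypothesis openM' : chart_open (tangent_atlas A) M'.

Lemma AM'_open_image i : open (chart_image i).
Proof.
have := @openM' i.
congr open; apply/seteqP; split=> [u [z [iz Mz] <-]|u [p ip <-]].
  by exists (SigSub (mem_set Mz)).
by exists (val p) => //; split => //; exact: (set_valP p).
Qed.

(** Equal x-coordinates give the same base point, as charts of M are injective;
    equal y-coordinates then give the same tangent vector. *)
Lemma AM'_inj_coord i p p' :
  dom i p -> dom i p' -> coord i p = coord i p' -> p = p'.
Proof.
have [_ _ charts _ _] := mfdA.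
move=> ip ip' /eq_row_mx [exy evec].
have [_ inj] := charts i.
apply: val_inj; case: p p' ip ip' exy evec => [[x v tv] +] [[x' v' tv'] +] /=.
move=> _ _ ix ix' exx' evv'.
have ? : x = x' by apply: inj exx'; exact: mem_set.
subst x'; have ? : v = v' by exact: tangent_inj ix tv tv' evv'.
by subst v'; congr TVec; exact: Prop_irrelevance.
Qed.

Let repB := @repE R (m + m) M' B AM'_inj_coord.

(** A map of the coordinates (x, y) that depends on x alone has no derivative in
    the direction of y. *)
Lemma diff_base (W : normedModType R) (f : 'rV[R]_(m + m) -> W) i p
    (w : 'rV[R]_(m + m)) :
  dom i p ->
  (forall q q', dom i q -> dom i q' -> base (val q) = base (val q') ->
     f (coord i q) = f (coord i q')) ->
  lsubmx w = 0 -> 'd f (coord i p) w = 0.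
Proof.
move=> ip fx w0.
have [df|] := pselect (differentiable f (coord i p)); last first.
  exact: diff_not_differentiable.
(* The difference quotients vanish as soon as h w + (x, y) is in the chart
   image. *)
rewrite -deriveE // /derive; apply: cvg_lim => //.
have near_image : \forall h \near (0 : R), chart_image i (h *: w + coord i p).
  apply: (@near0Z _ _ _ [set v | chart_image i (v + coord i p)]).
  have : \forall v \near coord i p, chart_image i v.
    by apply: open_nbhs_nbhs; split; [exact: AM'_open_image | exists p].
  by rewrite (near_shift 0) subr0.
apply: cvg_near_cst; apply: nbhs_dnbhs.
apply: filterS near_image => h [q iq eq].
rewrite /= -eq (fx q p) ?subrr ?scaler0 //.
have [_ _ charts _ _] := mfdA.
have [_ inj] := charts i.
apply: inj; [exact: mem_set|exact: mem_set|].
move/(congr1 lsubmx): eq; rewrite linearD linearZ /= w0 scaler0 add0r.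
by rewrite !row_mxKl.
Qed.

Lemma lsubmx_diff (V : normedModType R) (f : V -> 'rV[R]_(m + m)) x v :
  differentiable f x -> lsubmx ('d f x v) = 'd (lsubmx \o f) x v.
Proof.
move=> df.
have dl w : differentiable (lsubmx : 'rV[R]_(m + m) -> 'rV[R]_m) w.
  exact: differentiable_lsubmx.
have dlE : 'd lsubmx (f x) = lsubmx :> ('rV[R]_(m + m) -> 'rV[R]_m).
  by apply: diff_lin => ?; exact: continuous_lsubmx.
by rewrite (diff_comp df (dl _)) /= dlE.
Qed.

(** In coordinates the projection is (x, y) |-> x, and x' is a function of x
    alone in a transition map (x, y) |-> (x', y').  So the projection of u, read
    in the chart i, is the x-component of u i, and the vanishing of the
    x-component does not depend on the chart.  At a point where the transition
    map had no differential in the analytic sense, its differential would be the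
    zero map, and the components that it produces would vanish. *)
Lemma verticalP i p u :
  dom i p -> tangent p u -> vertical p u <-> lsubmx (u i) = 0.
Proof.
move=> ip tu; have cp := chart_atP B p; set c := chart_at B p in cp *.
have projE j (k : idx B) :
    rep (fun z => coord (k : idx A) (proj z)) j
    = lsubmx \o rep (T := M') (A := B) (coord k) j
    :> ('rV[R]_(m + m) -> 'rV[R]_m).
  apply: (rep_unique AM'_inj_coord) => [q jq|w nw] /=.
    by rewrite repB // row_mxKl.
  by rewrite rep_out // linear0.
have [_ tij] := tu.
split=> [[_ /(congr1 (fun v => v i))]|ui0].
  rewrite /push asboolT // -/c projE (tij c i) // => pu0.
  have [df|ndf] := pselect (differentiable (rep (coord i) c) (coord c p)).
    by rewrite lsubmx_diff.
  by rewrite diff_not_differentiable // linear0.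
have uc0 : lsubmx (u c) = 0.
  rewrite (tij i c) //.
  have [df|ndf] := pselect (differentiable (rep (coord c) i) (coord i p)).
    rewrite lsubmx_diff //; apply: diff_base => // q q' iq iq' qq'.
    by rewrite /= !repB // !row_mxKl qq'.
  by rewrite diff_not_differentiable // linear0.
split=> //; apply/funext => j; rewrite /push; case: asboolP => // jp.
apply: diff_base => // q q' cq cq' qq'.
by rewrite !repB // /proj qq'.
Qed.

Lemma vertical_tangent p u : vertical p u -> tangent p u.
Proof. by case. Qed.

Lemma vertical_comb p (c : R) u v :
  vertical p u -> vertical p v -> vertical p (c *: u + v).
Proof.
move=> /[dup] [[tu _]] + /[dup] [[tv _]].
have cp := chart_atP B p; have tuv := tangent_comb c tu tv.
rewrite !(verticalP cp) // => u0 v0.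
by rewrite comps_lin linearP /= u0 v0 scaler0 addr0.
Qed.

Lemma vertical0 p : vertical p (0 : comps B).
Proof.
by apply/(verticalP (chart_atP B p) (tangent0 _ _)); rewrite linear0.
Qed.

(** * The splitting into horizontal and vertical parts *)

Section Splitting.
Context (H : M' -> set (comps B))
  (N : idx B -> 'rV[R]_(m + m) -> 'M[R]_m) (J : M' -> comps B -> comps B).
Hypothesis Hnlc : nonlinear_connection H N.
Hypothesis Jac : almost_complex N J.

Definition hor i p (x : 'rV[R]_m) : comps B := \sum_a x 0 a *: delta_x N i p a.
Definition ver i p (y : 'rV[R]_m) : comps B := \sum_a y 0 a *: d_y i p a.

Let coord_vecB := coord_vec_id AM'_inj_coord AM'_open_image.

Lemma lsubmx_e_x a : lsubmx (e_x R a) = delta_mx 0 a :> 'rV[R]_m.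
Proof. exact: row_mxKl. Qed.
Lemma lsubmx_e_y a : lsubmx (e_y R a) = 0 :> 'rV[R]_m.
Proof. exact: row_mxKl. Qed.

Lemma hor_coord i p x : dom i p ->
  hor i p x i = \sum_a (x 0 a *: e_x R a
    - \sum_b (x 0 a * N i (coord i p) b a) *: e_y R b).
Proof.
move=> ip; rewrite /hor comps_sum; apply: eq_bigr => a _.
rewrite /delta_x -[LHS]/(x 0 a *:
  (d_x i p a i - (\sum_b N i (coord i p) b a *: d_y i p b) i)).
rewrite comps_sum scalerBr scaler_sumr /d_x coord_vecB //; congr (_ - _).
apply: eq_bigr => b _.
rewrite -[LHS]/(x 0 a *: (N i (coord i p) b a *: d_y i p b i)) /d_y.
by rewrite coord_vecB // scalerA.
Qed.

Lemma lsubmx_hor i p x : dom i p -> lsubmx (hor i p x i) = x.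
Proof.
move=> ip; rewrite hor_coord // linear_sum /= [RHS]row_sum_delta.
apply: eq_bigr => a _; rewrite linearB linearZ /= lsubmx_e_x linear_sum /=.
rewrite big1 ?subr0 // => b _.
by rewrite linearZ /= lsubmx_e_y scaler0.
Qed.

Lemma ver_coord i p y : dom i p -> ver i p y i = row_mx 0 y.
Proof.
move=> ip; rewrite /ver comps_sum.
transitivity (\sum_a y 0 a *: e_y R a).
  by apply: eq_bigr => a _; rewrite -[LHS]/(_ *: d_y i p a i) /d_y coord_vecB.
rewrite -[LHS]hsubmxK; congr row_mx; rewrite linear_sum /=.
  by rewrite big1 // => a _; rewrite linearZ /= lsubmx_e_y scaler0.
rewrite [RHS]row_sum_delta; apply: eq_bigr => a _.
by rewrite linearZ /= [rsubmx _]row_mxKr.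
Qed.

Lemma hor_H i p x : dom i p -> H p (hor i p x).
Proof. by have [_ _ _ HE] := Hnlc => ip; rewrite (HE i p) //; exists (x 0). Qed.

Lemma H_hor i p w : dom i p -> H p w -> exists x, w = hor i p x.
Proof.
have [_ _ _ HE] := Hnlc => ip; rewrite (HE i p) // => -[c ->].
by exists (\row_a c a); apply: eq_bigr => a _; rewrite mxE.
Qed.

Lemma hor_tangent i p x : dom i p -> tangent p (hor i p x).
Proof. by have [HT _ _ _] := Hnlc => ip; apply: HT; exact: hor_H. Qed.

Lemma hor_delta i p a : hor i p (delta_mx 0 a) = delta_x N i p a.
Proof.
rewrite /hor (bigD1 a) //= mxE !eqxx scale1r big1 ?addr0 // => b /negPf nba.
by rewrite mxE nba andbF scale0r.
Qed.

Lemma delta_x_tangent i p a : dom i p -> tangent p (delta_x N i p a).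
Proof. by rewrite -hor_delta; exact: hor_tangent. Qed.

(** The compatibility of the components of d/dy^a in different charts comes for
    free: horizontal vectors are tangent, J preserves tangency and sends
    delta/delta x^a to - d/dy^a. *)
Lemma d_y_tangent i p a : dom i p -> tangent p (d_y i p a).
Proof.
have [[JT _ _] JE] := Jac => ip; have [JxE _] := JE i p a ip.
have := JT _ _ (delta_x_tangent a ip); rewrite JxE => tN.
by have := tangent_comb (-1) tN (tangent0 _ _); rewrite scaleN1r opprK addr0.
Qed.

Lemma d_y_vertical i p a : dom i p -> vertical p (d_y i p a).
Proof.
move=> ip; apply/(verticalP ip (d_y_tangent a ip)).
by rewrite /d_y coord_vecB // lsubmx_e_y.
Qed.

Lemma ver_vertical i p y : dom i p -> vertical p (ver i p y).
Proof.
move=> ip; rewrite /ver; elim/big_ind: _ => [|u v vu vv|a _].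
- exact: vertical0.
- by rewrite -[u]scale1r; exact: vertical_comb.
- rewrite -[_ *: _]addr0; apply: vertical_comb (vertical0 _).
  exact: d_y_vertical.
Qed.

Lemma vertical_ver i p u : dom i p -> vertical p u ->
  u = ver i p (rsubmx (u i)).
Proof.
move=> ip /[dup] vu [tu _]; have vv := ver_vertical (rsubmx (u i)) ip.
apply: (tangent_inj ip tu (vertical_tangent vv)).
rewrite ver_coord // -[LHS]hsubmxK; congr row_mx.
exact/(verticalP ip tu).
Qed.

Lemma JD p u v : tangent p u -> tangent p v -> J p (u + v) = J p u + J p v.
Proof.
have [[_ JL _] _] := Jac => tu tv.
by have := JL p 1 u v tu tv; rewrite !scale1r.
Qed.

Lemma JZ p c u : tangent p u -> J p (c *: u) = c *: J p u.
Proof.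
have [[_ JL _] _] := Jac => tu; have t0 := tangent0 B p.
have J0 : J p 0 = 0.
  by have := JL p (-1) 0 0 t0 t0; rewrite scaler0 addr0 scaleN1r addNr.
by rewrite -[c *: u]addr0 JL // J0 addr0.
Qed.

Lemma J_hor i p x : dom i p -> J p (hor i p x) = - ver i p x.
Proof.
have [[_ JL _] JE] := Jac => ip.
rewrite /hor (lin_sum (V := @tangent _ _ _ B p)) //.
- rewrite /ver -sumrN; apply: eq_bigr => a _.
  by have [-> _] := JE i p a ip; rewrite scalerN.
- exact: tangent0.
- exact: tangent_comb.
- by move=> c u v; exact: JL.
- by move=> a; exact: delta_x_tangent.
Qed.

Lemma J_ver i p y : dom i p -> J p (ver i p y) = hor i p y.
Proof.
have [[_ JL _] JE] := Jac => ip.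
rewrite /ver (lin_sum (V := @tangent _ _ _ B p)) //.
- by apply: eq_bigr => a _; have [_ ->] := JE i p a ip.
- exact: tangent0.
- exact: tangent_comb.
- by move=> c u v; exact: JL.
- by move=> a; exact: d_y_tangent.
Qed.

Lemma horN i p x : hor i p (- x) = - hor i p x.
Proof. by rewrite /hor -sumrN; apply: eq_bigr => a _; rewrite mxE scaleNr. Qed.

Lemma verN i p y : ver i p (- y) = - ver i p y.
Proof. by rewrite /ver -sumrN; apply: eq_bigr => a _; rewrite mxE scaleNr. Qed.

Lemma hpart_spec X p : tangent p (X p) ->
  H p (hpart H X p) /\ vertical p (vpart H X p).
Proof.
have [_ dec _ _] := Hnlc => tX.
have [w [Pw _]] := dec p _ tX.
exact: (xgetPex 0 (P := [set w | H p w /\ vertical p (X p - w)])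
  (ex_intro _ w Pw)).
Qed.

(** The vertical vector X - hX has no x-component, hence X and hX have the same
    one; and a horizontal vector is determined by its x-component. *)
Lemma hpartE i X p : dom i p -> tangent p (X p) ->
  hpart H X p = hor i p (lsubmx (X p i)).
Proof.
move=> ip tX; have [/(H_hor ip)[x hx] vX] := hpart_spec tX.
have := (verticalP ip (vertical_tangent vX)).1 vX.
rewrite -[vpart H X p i]/(X p i - hpart H X p i) hx linearB /= lsubmx_hor //.
by move/subr0_eq => ->.
Qed.

Lemma JJ_hpart X p : tangent p (X p) ->
  J p (J p (hpart H X p)) = - hpart H X p.
Proof.
move=> tX; have cp := chart_atP B p.
by rewrite (hpartE cp tX) J_hor // -verN J_ver // horN.
Qed.

Lemma vpartE i X p : dom i p -> tangent p (X p) -> exists y,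
  vpart H X p = ver i p y.
Proof.
by move=> ip /hpart_spec [_ vX]; eexists; exact: (vertical_ver ip vX).
Qed.

Lemma hpart_comb X Y Z p (c : R) : tangent p (X p) -> tangent p (Y p) ->
  Z p = c *: X p + Y p -> hpart H Z p = c *: hpart H X p + hpart H Y p.
Proof.
move=> tX tY ZE; have cp := chart_atP B p.
have tZ : tangent p (Z p) by rewrite ZE; exact: tangent_comb.
rewrite !(hpartE cp) // ZE comps_lin linearP /= /hor scaler_sumr -big_split /=.
by apply: eq_bigr => a _; rewrite !mxE scalerDl scalerA.
Qed.

Lemma vpart_comb X Y Z p (c : R) : tangent p (X p) -> tangent p (Y p) ->
  Z p = c *: X p + Y p -> vpart H Z p = c *: vpart H X p + vpart H Y p.
Proof.
move=> tX tY ZE; rewrite -[LHS]/(Z p - hpart H Z p) (hpart_comb tX tY ZE) ZE.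
rewrite -[vpart H X p]/(X p - hpart H X p) -[vpart H Y p]/(Y p - hpart H Y p).
by rewrite scalerBr opprD addrACA.
Qed.

(** In a chart, hX has the components (x^a, - N^b_a x^a), where x is the
    x-component of X: products of smooth functions. *)
Lemma smooth_hpart X : smooth_vfield X -> smooth_vfield (hpart H X).
Proof.
move=> [tX sX]; have [_ _ sN _] := Hnlc; split=> [p|i].
  by rewrite (hpartE (chart_atP B p) (tX p)); 
  exact: hor_tangent (chart_atP _ _).
pose r := rep (fun p => X p i) i.
have oi : open (chart_image i) by exact: AM'_open_image.
have sr a : smooth_on (chart_image i) (fun u => r u 0 a : R).
  by apply: smooth_on_coord.
rewrite (_ : rep _ i = fun u => \sum_a (r u 0 (lshift m a) *: e_x R a
    - \sum_b (r u 0 (lshift m a) * N i u b a) *: e_y R b)).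
  apply: smooth_on_sum => // a; apply: smooth_onD => //.
    exact: smooth_onZl.
  apply: smooth_onN => //; apply: smooth_on_sum => // b.
  by apply: smooth_onZl => //; apply: smooth_onM => //; exact: smooth_on_coord.
apply: (rep_unique AM'_inj_coord) => [p ip|u nu].
  rewrite /r repB // (hpartE ip) // hor_coord //.
  by apply: eq_bigr => a _; rewrite mxE.
rewrite big1 // => a _; rewrite /r rep_out // mxE scale0r big1 ?subr0 // => b _.
by rewrite mul0r scale0r.
Qed.

Lemma smooth_vpart X : smooth_vfield X -> vertical_vfield (vpart H X).
Proof.
move=> sX; split; last by move=> p; case: sX => tX _; case: (hpart_spec (tX p)).
exact: smooth_vfieldD AM'_inj_coord AM'_open_image _ _ sX
  (smooth_vfieldN AM'_inj_coord AM'_open_image (smooth_hpart sX)).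
Qed.

Lemma smooth_Jhpart X :
  smooth_vfield X -> vertical_vfield (on_fields J (hpart H X)).
Proof.
have [[_ _ sJ] _] := Jac => sX; split; first exact/sJ/smooth_hpart.
case: sX => tX _ p; have cp := chart_atP B p.
by rewrite /on_fields (hpartE cp (tX p)) J_hor // -verN; exact: ver_vertical.
Qed.

(** * The natural almost complex connection *)

Section NaturalConnection.
Context (nabla : vfield B -> vfield B -> vfield B).
Hypothesis lin_nabla : linear_connection (@vertical_vfield _ _ _ _ M') nabla.
Let D := natural_connection H J nabla.

(** J exchanges HM' and VM', so P is the vertical part of P - JQ and -JQ its
    horizontal part; moreover J(-JQ) = Q. *)
Lemma parts_subJ P Q p : vertical p (P p) -> vertical p (Q p) ->
  let W := P - on_fields J Q in
  [/\ tangent p (W p), vpart H W p = P p & J p (hpart H W p) = Q p].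
Proof.
move=> vP vQ W; have cp := chart_atP B p; set i := chart_at B p in cp.
have JQ : J p (Q p) = hor i p (rsubmx (Q p i)).
  by rewrite [in LHS](vertical_ver cp vQ) J_ver.
have WE : W p = P p - J p (Q p) by [].
have tW : tangent p (W p).
  rewrite WE addrC -scaleN1r; apply: tangent_comb; last exact: vertical_tangent.
  by rewrite JQ; exact: hor_tangent.
have hW : hpart H W p = - J p (Q p).
  rewrite (hpartE cp tW) JQ -horN; congr hor.
  rewrite WE -[(_ - _) i]/(P p i - J p (Q p) i) linearB /= JQ lsubmx_hor //.
  by rewrite ((verticalP cp (vertical_tangent vP)).1 vP) sub0r.
split=> //.
  by rewrite -[vpart _ _ _]/(W p - hpart H W p) hW WE opprK subrK.
rewrite hW JQ -horN J_hor // verN opprK.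
by rewrite -(vertical_ver cp vQ).
Qed.

Lemma natural_parts X Y p : smooth_vfield X -> smooth_vfield Y ->
  [/\ tangent p (D X Y p), vpart H (D X Y) p = nabla X (vpart H Y) p &
      J p (hpart H (D X Y) p) = nabla X (on_fields J (hpart H Y)) p].
Proof.
have [nE _ _ _ _] := lin_nabla => sX sY; apply: parts_subJ.
  by have [_] := nE _ _ sX (smooth_vpart sY).
by have [_] := nE _ _ sX (smooth_Jhpart sY).
Qed.

Lemma natural_connection_linear :
  linear_connection (@smooth_vfield _ _ _ B) D.
Proof.
have [nE nDl nZl nDr nZr] := lin_nabla.
have tN X Y p : smooth_vfield X -> vertical_vfield Y -> tangent p (nabla X Y p).
  by move=> sX vY; have [[t _] _] := nE _ _ sX vY; exact: t.
split.
- move=> X Y sX sY; have [[_ _ sJ] _] := Jac.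
  have [sv _] := nE _ _ sX (smooth_vpart sY).
  have [sj _] := nE _ _ sX (smooth_Jhpart sY).
  apply: (smooth_vfieldD AM'_inj_coord AM'_open_image) => //.
  by apply: (smooth_vfieldN AM'_inj_coord AM'_open_image); exact: sJ.
- move=> X X' Y sX sX' sY.
  have [vY jY] := (smooth_vpart sY, smooth_Jhpart sY).
  rewrite /D /natural_connection !nDl //; apply/funext => p.
  rewrite -[LHS]/(_ + _ - J p (_ + _)) JD; [|exact: tN|exact: tN].
  by rewrite opprD addrACA.
- move=> f X Y sf sX sY.
  have [vY jY] := (smooth_vpart sY, smooth_Jhpart sY).
  rewrite /D /natural_connection !nZl //; apply/funext => p.
  rewrite -[LHS]/(f p *: _ - J p (f p *: _)) JZ; last exact: tN.
  by rewrite -scalerBr.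
- move=> X Y Y' sX sY sY'.
  have [vY jY] := (smooth_vpart sY, smooth_Jhpart sY).
  have [vY' jY'] := (smooth_vpart sY', smooth_Jhpart sY').
  have YE p : (Y + Y') p = 1 *: Y p + Y' p by rewrite scale1r.
  have [[tY _] [tY' _]] := (sY, sY').
  have hD : hpart H (Y + Y') = hpart H Y + hpart H Y'.
    by apply/funext => p; rewrite (hpart_comb (tY p) (tY' p) (YE p)) scale1r.
  have vD : vpart H (Y + Y') = vpart H Y + vpart H Y'.
    by apply/funext => p; rewrite (vpart_comb (tY p) (tY' p) (YE p)) scale1r.
  have jD : on_fields J (hpart H (Y + Y'))
      = on_fields J (hpart H Y) + on_fields J (hpart H Y').
    have [[th _] [th' _]] := (smooth_hpart sY, smooth_hpart sY').
    by rewrite hD; apply/funext => p; exact: JD.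
  rewrite /D /natural_connection vD jD.
  rewrite (nDr _ _ _ sX vY vY') (nDr _ _ _ sX jY jY'); apply/funext => p.
  rewrite -[LHS]/(_ + _ - J p (_ + _)) JD; [|exact: tN|exact: tN].
  by rewrite opprD addrACA.
- move=> f X Y sf sX sY.
  have [vY jY] := (smooth_vpart sY, smooth_Jhpart sY).
  have [tY _] := sY; have [th _] := smooth_hpart sY.
  have fYE p : fscale f Y p = f p *: Y p + (0 : vfield B) p by rewrite addr0.
  have t0 p : tangent p ((0 : vfield B) p) by exact: tangent0.
  have h0 p : hpart H 0 p = 0.
    have := hpart_comb (c := -1) (Z := 0) (t0 p) (t0 p).
    by rewrite scaler0 addr0 scaleN1r addNr => ->.
  have hf : hpart H (fscale f Y) = fscale f (hpart H Y).
    by apply/funext => p; rewrite (hpart_comb (tY p) (t0 p) (fYE p)) h0 addr0.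
  have vf : vpart H (fscale f Y) = fscale f (vpart H Y).
    apply/funext => p; rewrite -[LHS]/(f p *: Y p - hpart H (fscale f Y) p) hf.
    by rewrite -scalerBr.
  have jf : on_fields J (hpart H (fscale f Y))
      = fscale f (on_fields J (hpart H Y)).
    by rewrite hf; apply/funext => p; exact: JZ.
  rewrite /D /natural_connection vf jf.
  rewrite (nZr _ _ _ sf sX vY) (nZr _ _ _ sf sX jY); apply/funext => p.
  set P := nabla X _; set Q := nabla X _.
  have tQ : tangent p (Q p) by exact: tN.
  rewrite -[LHS]/(der X f p *: vpart H Y p + f p *: P p
    - J p (der X f p *: J p (hpart H Y p) + f p *: Q p)).
  have tJ : tangent p (J p (hpart H Y p)).
    by have [[tJ _] _] := jY; exact: tJ.
  rewrite JD; last 2 first.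
  - by rewrite -[_ *: _]addr0; exact: tangent_comb (tangent0 _ _).
  - by rewrite -[_ *: _]addr0; exact: tangent_comb (tangent0 _ _).
  (* The two terms in Xf, on vY and on - J(JhY) = hY, add up to Xf Y. *)
  rewrite !JZ // JJ_hpart //.
  rewrite -[RHS]/(der X f p *: Y p + f p *: (P p - J p (Q p))).
  rewrite -[vpart H Y p]/(Y p - hpart H Y p) !scalerBr scalerN opprD opprK.
  by rewrite [LHS]addrACA subrK.
Qed.

End NaturalConnection.

(** * Compatibility with the Sasaki-type metric *)

Section Metric.
Context (q : nat) (F : M' -> R) (g G : M' -> comps B -> comps B -> R).
Hypothesis pF : pseudo_finsler q F.
Hypothesis gF : vertical_metric F g.
Hypothesis GF : sasaki_metric F N G.

Definition metric_sum i p (y z : 'rV[R]_m) : R :=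
  \sum_a \sum_b y 0 a * (z 0 b * fundamental F i (coord i p) a b).

Lemma g_ver i p y z : dom i p ->
  g p (ver i p y) (ver i p z) = metric_sum i p y z.
Proof.
have [bil gE] := gF => ip; rewrite /ver (fibre_bilinear_sum _ _ bil).
- by apply: eq_bigr => a _; apply: eq_bigr => b _; rewrite gE.
- exact: vertical0.
- by move=> c u v; exact: vertical_comb.
- by move=> a; exact: d_y_vertical.
- by move=> a; exact: d_y_vertical.
Qed.

(** The sign in J(delta/delta x^a) = - d/dy^a cancels in g(J., J.). *)
Lemma metric_sumNN i p y z : metric_sum i p (- y) (- z) = metric_sum i p y z.
Proof.
apply: eq_bigr => a _; apply: eq_bigr => b _.
by rewrite !mxE !mulNr mulrN opprK.
Qed.

Lemma G_split i p x x' y y' : dom i p ->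
  G p (hor i p x + ver i p y) (hor i p x' + ver i p y')
  = metric_sum i p y y' + metric_sum i p x x'.
Proof.
have [bil GE] := GF => ip.
have t0 := tangent0 B p; have tL := @tangent_comb _ _ _ B p.
have tx a := delta_x_tangent a ip; have ty a := d_y_tangent a ip.
have th z := hor_tangent z ip.
have tv z := vertical_tangent (ver_vertical z ip).
have thv : tangent p (hor i p x' + ver i p y').
  by rewrite -[hor _ _ _]scale1r; exact: tL.
have [+ _] := bil p 1 _ _ _ (th x) (tv y) thv; rewrite scale1r mul1r => ->.
have [_] := bil p 1 _ _ _ (th x') (tv y') (th x); rewrite scale1r mul1r => ->.
have [_] := bil p 1 _ _ _ (th x') (tv y') (tv y); rewrite scale1r mul1r => ->.
rewrite /hor /ver !(fibre_bilinear_sum _ _ bil) //.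
rewrite [X in _ + X + _]big1 ?addr0; last first.
  move=> a _; rewrite big1 // => b _.
  by have [_ _ -> _] := GE i p a b ip; rewrite !mulr0.
rewrite [X in _ + (X + _)]big1 ?add0r; last first.
  move=> a _; rewrite big1 // => b _.
  by have [_ _ _ ->] := GE i p b a ip; rewrite !mulr0.
rewrite addrC; congr (_ + _); apply: eq_bigr => a _; apply: eq_bigr => b _.
  by have [_ -> _ _] := GE i p a b ip.
by have [-> _ _ _] := GE i p a b ip.
Qed.

(** G does not mix HM' and VM', and J is an isometry from HM' to VM'. *)
Lemma sasaki_split X Y p : tangent p (X p) -> tangent p (Y p) ->
  G p (X p) (Y p) = g p (vpart H X p) (vpart H Y p)
    + g p (J p (hpart H X p)) (J p (hpart H Y p)).
Proof.
move=> tX tY; have cp := chart_atP B p.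
have XE Z : Z p = hpart H Z p + vpart H Z p.
  by rewrite -[vpart H Z p]/(Z p - hpart H Z p) addrC subrK.
rewrite (XE X) (XE Y) !(hpartE cp) //.
have [y ->] := vpartE cp tX; have [z ->] := vpartE cp tY.
by rewrite G_split // !J_hor // -!verN !g_ver // metric_sumNN.
Qed.

Lemma smooth_fundamental i a b :
  smooth_on (chart_image i) (fun u => fundamental F i u a b).
Proof.
have [_ sF _ _ _] := pF; have oi := @AM'_open_image i.
rewrite (_ : (fun u => _) = (cst 2^-1 : _ -> R) * (fun u => 'D_(e_y R a)
    (fun w => 'D_(e_y R b) (rep (A := B) F i) w) u)).
  apply: smooth_onM => //; first by move=> k; exact: Ck_on_cst.
  by do 2 apply: smooth_on_derive; exact: sF.
by apply/funext => u; rewrite mxE.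
Qed.

(** In a chart, g(Y, Z) = Y^a Z^b g_ab. *)
Lemma differentiable_g Y Z i p : vertical_vfield Y -> vertical_vfield Z ->
  dom i p ->
  differentiable (rep (fun p => g p (Y p) (Z p)) i) (coord i p).
Proof.
move=> [[_ sY] vY] [[_ sZ] vZ] ip; have oi := @AM'_open_image i.
apply: (smooth_on_differentiable (U := chart_image i)); last by exists p.
rewrite (_ : rep _ i = fun u => \sum_a \sum_b
    rep (fun p => Y p i) i u 0 (rshift m a)
    * (rep (fun p => Z p i) i u 0 (rshift m b)
      * fundamental F i u a b)).
  apply: smooth_on_sum => // a; apply: smooth_on_sum => // b.
  have sYa := smooth_on_coord 0 (rshift m a) oi (sY i).
  have sZb := smooth_on_coord 0 (rshift m b) oi (sZ i).
  exact: smooth_onM oi sYa (smooth_onM oi sZb (smooth_fundamental i a b)).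
apply: (rep_unique AM'_inj_coord) => [z iz|u nu].
  rewrite !repB // [in RHS](vertical_ver iz (vY z)).
  rewrite [in RHS](vertical_ver iz (vZ z)).
  rewrite g_ver //; apply: eq_bigr => a _; apply: eq_bigr => b _.
  by rewrite !mxE.
by rewrite big1 // => a _; rewrite big1 // => b _; rewrite rep_out // mxE mul0r.
Qed.

Context (nabla : vfield B -> vfield B -> vfield B).
Hypothesis lin_nabla : linear_connection (@vertical_vfield _ _ _ _ M') nabla.
Hypothesis metric_nabla :
  metric_connection (@vertical_vfield _ _ _ _ M') nabla g.
Let D := natural_connection H J nabla.

Lemma natural_connection_metric :
  metric_connection (@smooth_vfield _ _ _ B) D G.
Proof.
move=> X Y Z sX sY sZ p; have [tY _] := sY; have [tZ _] := sZ.
have cp := chart_atP B p.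
rewrite /cov_der.
have -> : (fun z => G z (Y z) (Z z))
  = (fun z => g z (vpart H Y z) (vpart H Z z))
    + (fun z => g z (on_fields J (hpart H Y) z) (on_fields J (hpart H Z) z)).
  by apply/funext => z; rewrite (sasaki_split (tY z) (tZ z)).
have [vY vZ] := (smooth_vpart sY, smooth_vpart sZ).
have [jY jZ] := (smooth_Jhpart sY, smooth_Jhpart sZ).
rewrite (derD AM'_inj_coord); [|exact: differentiable_g..].
have [tDY vDY jDY] := natural_parts lin_nabla p sX sY.
have [tDZ vDZ jDZ] := natural_parts lin_nabla p sX sZ.
rewrite (sasaki_split tDY (tZ p)) (sasaki_split (tY p) tDZ) vDY vDZ jDY jDZ.
have := metric_nabla sX vY vZ p; have := metric_nabla sX jY jZ p.
rewrite /cov_der => /subr0_eq + /subr0_eq.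
move=> /(canRL (subrK _)) -> /(canRL (subrK _)) ->.
rewrite /on_fields; ring.
Qed.

End Metric.

End Splitting.

End TangentSubset.

Theorem theorem4 (R : realType) (m q : nat) (M : topologicalType)
    (A : atlas R m M) (M' : set (tangent_bundle A)) (F : M' -> R)
    (H : M' -> set (comps (AM' M')))
    (N : idx (AM' M') -> 'rV[R]_(m + m) -> 'M[R]_m)
    (g : M' -> comps (AM' M') -> comps (AM' M') -> R)
    (J : M' -> comps (AM' M') -> comps (AM' M'))
    (S T : vfield (AM' M') -> vfield (AM' M') -> vfield (AM' M'))
    (nabla : vfield (AM' M') -> vfield (AM' M') -> vfield (AM' M'))
    (G : M' -> comps (AM' M') -> comps (AM' M') -> R) :
  smooth_manifold A ->
  pseudo_finsler q F ->
  nonlinear_connection H N ->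
  vertical_metric F g ->
  almost_complex N J ->
  skew_finsler_tensor S ->
  skew_finsler_tensor T ->
  cartan_connection g H J S T nabla ->
  sasaki_metric F N G ->
  let D := natural_connection H J nabla in
  let TM' : set (vfield (AM' M')) := @smooth_vfield R (m + m) M' (AM' M') in
  linear_connection TM' D /\ metric_connection TM' D G.
Proof.
move=> mfdA pF Hnlc gF Jac _ _ [lin_nabla metric_nabla _ _] GF D TM'.
have [[_ openM' _ _] _ _ _ _] := pF.
split; first exact: (natural_connection_linear mfdA openM' Hnlc Jac lin_nabla).
exact: (natural_connection_metric mfdA openM' Hnlc Jac pF gF GF lin_nabla).
Qed.
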